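(* Let $k\ge 1$ and $r\ge 1$ be integers and let $n=2k+r$. If $r>k-2$ (that is, $n>3k-2$), then $$diss(K_{n,k})\le \frac{k+1}{k}\binom{n-1}{k-1}.$$
   Context: For positive integers $n,k$ with $n\ge 2k$, the Kneser graph $K_{n,k}$ has as vertices all $k$-element subsets of $[n]=\{1,\dots,n\}$, two of them being adjacent if and only if they are disjoint. A set $D$ of vertices of a graph $G$ is a dissociation set if the subgraph of $G$ induced by $D$ has maximum degree at most $1$. The dissociation number $diss(G)$ is the maximum cardinality of a dissociation set in $G$. *)

(* Defs.v *)
From mathcomp Require Import all_boot all_order all_algebra.

Set Implicit Arguments.
Unset Strict Implicit.
Unset Printing Implicit Defensive.

(* A finite simple graph on T is given by its adjacency relation e : rel T,
   assumed symmetric and irreflexive; this holds for kneser below (k > 0). *)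

Definition max_degree (T : finType) (e : rel T) : nat :=
  \max_(x : T) #|[set y | e x y]|.

Definition induced (T : finType) (e : rel T) (D : {set T}) :
    rel {x : T | x \in D} :=
  fun x y => e (val x) (val y).

Definition dissociation_set (T : finType) (e : rel T) (D : {set T}) : bool :=
  max_degree (@induced T e D) <= 1.

Definition diss (T : finType) (e : rel T) : nat :=
  \max_(D : {set T} | dissociation_set e D) #|D|.

(* The ground set {1, ..., n} is represented by 'I_n = {0, ..., n - 1}. *)
Definition kneser (n k : nat) : rel {A : {set 'I_n} | #|A| == k} :=
  fun A B => [disjoint val A & val B].

Lemma kneser_sym (n k : nat) : symmetric (@kneser n k).
Proof. by move=> A B; rewrite /kneser disjoint_sym. Qed.

Lemma kneser_irr (n k : nat) : 0 < k -> irreflexive (@kneser n k).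
Proof.
move=> k_gt0 A; apply/negbTE; rewrite /kneser -setI_eq0 setIid -card_gt0.
by rewrite (eqP (valP A)).
Qed.

(* Main.v *)
Require Import Defs.
From mathcomp Require Import all_boot all_order all_algebra.
From mathcomp Require Import all_fingroup zify.
Import GRing.Theory Num.Theory.

(** The proof is Katona's cycle method.  Arrange the ground set on a circle and
    look only at the [n] arcs of [k] consecutive points.  Two arcs whose starting
    points are at circular distance at least [k] are disjoint, so a dissociation
    set meets the arcs in a set [S] of starting points each of which is far from
    at most one other.  Such an [S] has at most [k + 1] elements
    ([card_dissociated_starts]): if no two of them are far apart, this is
    Katona's bound [k]; otherwise fix two far points [a < b].  All remaining
    points are near both [a] and [b], which leaves [2k - 1 - (b - a)] places on
    one side of the circle and [2k - 1 - (n - (b - a))] on the other (none where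
    this is negative).  Since [b - a] and [n - (b - a)] are at least [k], one side
    alone offers at most [k - 1] places, and both together offer [4k - 2 - n]
    places, at most [k - 1] exactly because [n >= 3k - 1].

    Averaging over all circular arrangements turns the local bound [k + 1] out of
    [n] into a global one.  By symmetry a random permutation sends a given arc to
    a uniformly distributed [k]-set ([card_perms_into_family]), so a dissociation
    set [F] satisfies [n * #|F| <= (k + 1) * 'C(n, k)], and
    [n * 'C(n - 1, k - 1) = k * 'C(n, k)] gives the stated form. *)

Set Implicit Arguments.
Unset Strict Implicit.
Unset Printing Implicit Defensive.

(** * Dissociation sets *)

Lemma dissociation_set_unique (T : finType) (e : rel T) (D : {set T}) :
  dissociation_set e D ->
  forall x y z, x \in D -> y \in D -> z \in D -> e x y -> e x z -> y = z.
Proof.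
move=> /bigmax_leqP hD x y z xD yD zD exy exz.
have /card_le1_eqP h := hD (exist _ x xD) isT.
have := h (exist _ y yD) (exist _ z zD).
by rewrite !inE /induced /= => /(_ exy exz) [].
Qed.

(** * Far points on a circle *)

Lemma card_le_of_inj_nat (T : finType) (S : {set T}) (f : T -> nat) (m : nat) :
  {in S &, injective f} -> {in S, forall x, f x < m} -> #|S| <= m.
Proof.
move=> f_inj f_lt; rewrite cardE -(size_map f) -(size_iota 0 m).
apply: uniq_leq_size.
  rewrite map_inj_in_uniq ?enum_uniq // => x y.
  by rewrite !mem_enum; apply: f_inj.
move=> _ /mapP[x xS ->]; rewrite mem_iota /=.
by apply: f_lt; rewrite -mem_enum.
Qed.

(** Circular distance at least [k] between two points of the circle
    [{0, ..., n - 1}]. *)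
Definition far (n k i j : nat) : bool :=
  (i + k <= j) && (j + k <= i + n) || (j + k <= i) && (i + k <= j + n).

(** Clockwise distance from [a] to [x]. *)
Definition offset (n a x : nat) : nat := if a <= x then x - a else x + n - a.

Lemma offset_lt (n a x : nat) : a < n -> x < n -> offset n a x < n.
Proof. by rewrite /offset; case: (leqP a x) => h; lia. Qed.

Lemma offset_inj (n a : nat) (x y : 'I_n) :
  a < n -> offset n a x = offset n a y -> x = y.
Proof.
move=> lta exy; have := ltn_ord x; have := ltn_ord y => lty ltx.
apply: val_inj => /=; move: exy; rewrite /offset.
by case: (leqP a x) => hx; case: (leqP a y) => hy; lia.
Qed.

(** [far] is invariant under rotation. *)
Lemma far_offset (n k a x y : nat) : 0 < k -> a < n -> x < n -> y < n ->
  far n k (offset n a x) (offset n a y) -> far n k x y.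
Proof.
by rewrite /offset /far; case: (leqP a x) => hx; case: (leqP a y) => hy; lia.
Qed.

(** Katona's bound: measured clockwise from a fixed [a] in [S], every other point
    has offset [y] in [1, k - 1] or in [n - k + 1, n - 1].  The offsets [y] and
    [y + n - k] are far from each other, so lowering the large offsets by [n - k]
    keeps the points of [S] apart. *)
Lemma card_pairwise_near (n k : nat) (S : {set 'I_n}) :
  0 < k -> 2 * k <= n -> {in S &, forall i j : 'I_n, ~~ far n k i j} -> #|S| <= k.
Proof.
move=> k_gt0 le2kn near.
have [->|[a aS]] := set_0Vmem S; first by rewrite cards0.
pose o (x : 'I_n) := offset n a x.
have o_lt x : o x < n by apply: offset_lt.
have o_near : {in S &, forall x y, ~~ far n k (o x) (o y)}.
  by move=> x y xS yS; apply: contra (near _ _ xS yS); apply: far_offset.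
have o_range x : x \in S -> (o x < k) || (n < o x + k).
  move=> xS; have := o_near _ _ aS xS; have := o_lt x.
  by rewrite {2}/o /offset leqnn subnn /far; move: (o x) => p; lia.
pose code x := if o x < k then o x else o x + k - n.
apply: (@card_le_of_inj_nat _ _ code) => [x y xS yS|x xS].
- move=> exy; apply: (offset_inj (ltn_ord a)); rewrite -!/(o _).
  move: (o_near _ _ xS yS) (o_range _ xS) (o_range _ yS) (o_lt x) (o_lt y) exy.
  rewrite /code /far; move: (o x) (o y) => p q.
  by case: (ltnP p k) => hp; case: (ltnP q k) => hq; lia.
- move: (o_range _ xS) (o_lt x); rewrite /code; move: (o x) => p.
  by case: (ltnP p k) => hp; lia.
Qed.

(** The circle is cut at [a], so that points before [a] are shifted by [n]; in
    these coordinates the inner side is [(a, b)], the outer side is [(b, a + n)],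
    and being near both ends of a side bounds the place from both sides. *)
Lemma place_near_far_pair (n k a b x : nat) :
  x < n -> a < b -> b < n -> far n k a b -> x != a -> x != b ->
  ~~ far n k a x -> ~~ far n k b x ->
  let y := if x < a then x + n else x in
  [&& a < y, y < b, b < y + k & y < a + k] ||
  [&& b < y, y < a + n, a + n < y + k & y < b + k].
Proof.
move=> ltx ltab ltb fab xa xb fax fbx /=.
have {}fab : (a + k <= b) && (b + k <= a + n) by move: fab; rewrite /far; lia.
by case: (ltnP x a) => h; move: fax fbx; rewrite /far; lia.
Qed.

(** The points of [S] other than the far pair [a < b] are numbered by first
    running through the admissible places between [a] and [b], then through those
    on the outer side. *)
Lemma card_dissociated_far_pair (n k : nat) (S : {set 'I_n}) (a b : 'I_n) :
  0 < k -> 3 * k <= n + 1 ->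
  {in S & &, forall i j j' : 'I_n, far n k i j -> far n k i j' -> j = j'} ->
  a \in S -> b \in S -> a < b -> far n k a b -> #|S| <= k + 1.
Proof.
move=> k_gt0 le3kn uniq_far aS bS ltab fab.
have fba : far n k b a by rewrite /far orbC.
pose place (x : 'I_n) := if x < a then x + n else x : nat.
have place_inj : injective place.
  move=> x y; have := ltn_ord x; have := ltn_ord y.
  move=> lty ltx exy; apply: val_inj => /=; move: exy; rewrite /place.
  by case: (ltnP x a) => hx; case: (ltnP y a) => hy; lia.
pose code x := if place x < b then place x + k - b - 1
               else (2 * k - 1 - (b - a)) + (place x + k - (a + n) - 1).
have near x : x \in S :\ a :\ b ->
    [&& a < place x, place x < b, b < place x + k & place x < a + k] ||
    [&& b < place x, place x < a + n, a + n < place x + k & place x < b + k].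
  rewrite !inE => /and3P[xb xa xS]; apply: place_near_far_pair => //.
    by apply: contra xb => fax; apply/eqP/(uniq_far _ _ _ aS xS bS).
  by apply: contra xa => fbx; apply/eqP/(uniq_far _ _ _ bS xS aS).
have {fba}dist : (a + k <= b) && (b + k <= a + n).
  by clear -fab ltab k_gt0; move: fab; rewrite /far; lia.
have cardS : #|S| = (#|S :\ a :\ b|).+2.
  rewrite (cardsD1 a S) aS (cardsD1 b (S :\ a)) !inE bS.
  by rewrite -(inj_eq val_inj) /= gtn_eqF.
suff: #|S :\ a :\ b| <= k - 1 by rewrite cardS; lia.
apply: (@card_le_of_inj_nat _ _ code) => [x y /near nx /near ny exy|x /near nx].
  apply: place_inj; move: nx ny exy; rewrite /code.
  (* Abstracting the places leaves a statement of linear arithmetic. *)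
  move: (place x) (place y) => p q.
  by case: (ltnP p b) => hp; case: (ltnP q b) => hq; lia.
move: nx; rewrite /code; move: (place x) => p.
by case: (ltnP p b) => hp; lia.
Qed.

Lemma card_dissociated_starts (n k : nat) (S : {set 'I_n}) :
  0 < k -> 2 * k <= n -> 3 * k <= n + 1 ->
  {in S & &, forall i j j' : 'I_n, far n k i j -> far n k i j' -> j = j'} ->
  #|S| <= k + 1.
Proof.
move=> k_gt0 le2kn le3kn uniq_far.
have [/exists_inP[a aS /exists_inP[b bS fab]]|noFar] :=
    boolP [exists a in S, [exists b in S, far n k a b]]; last first.
  apply: leq_trans (leq_addr 1 k); apply: card_pairwise_near => // i j iS jS.
  apply: contra noFar => fij.
  by apply/exists_inP; exists i => //; apply/exists_inP; exists j.
case: (ltngtP a b) => ab.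
- exact: (@card_dissociated_far_pair n k S a b).
- apply: (@card_dissociated_far_pair n k S b a) => //.
  by move: fab; rewrite /far; lia.
- by move: fab; rewrite /far; lia.
Qed.

(** * Arcs *)

Definition arc (m k : nat) (i : 'I_m.+1) : {set 'I_m.+1} :=
  [set inZp (i + t) | t : 'I_k].

Lemma card_arc (m k : nat) (i : 'I_m.+1) : k <= m.+1 -> #|arc k i| = k.
Proof.
move=> lekn; rewrite card_imset ?card_ord // => t u /(congr1 val) /= etu.
apply: val_inj => /=; have := ltn_ord t; have := ltn_ord u => ltu ltt.
by move/eqP: etu; rewrite eqn_modDl !modn_small; [move/eqP | lia | lia].
Qed.

Lemma arc_start (m k : nat) (i : 'I_m.+1) : 0 < k -> i \in arc k i.
Proof.
move=> k_gt0; apply/imsetP; exists (Ordinal k_gt0) => //=.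
by rewrite addn0 valZpK.
Qed.

Lemma mem_arc (m k : nat) (i x : 'I_m.+1) : k <= m.+1 -> x \in arc k i ->
  (i <= x < i + k) || (x + m.+1 < i + k).
Proof.
move=> lekn /imsetP[t _ ->] /=.
have := ltn_ord t; have := ltn_ord i => lti ltt.
have [lt_n|le_n] := ltnP (i + t) m.+1; first by rewrite modn_small; lia.
rewrite -(subnK le_n) modnDr modn_small; lia.
Qed.

Lemma arc_inj (m k : nat) :
  0 < k -> 2 * k <= m.+1 -> injective (@arc m k).
Proof.
move=> k_gt0 le2kn i j eij.
have lekn : k <= m.+1 by lia.
have ij := arc_start i k_gt0; rewrite eij in ij; move/(mem_arc lekn): ij.
have ji := arc_start j k_gt0; rewrite -eij in ji; move/(mem_arc lekn): ji.
move=> h1 h2; apply: val_inj => /=.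
have := ltn_ord i; have := ltn_ord j; lia.
Qed.

Lemma arc_disjoint (m k : nat) (i j : 'I_m.+1) :
  k <= m.+1 -> far m.+1 k i j -> [disjoint arc k i & arc k j].
Proof.
move=> lekn fij; apply/pred0P=> x /=; apply/negP=> /andP[].
move=> /(mem_arc lekn) xi /(mem_arc lekn) xj; move: fij; rewrite /far.
have := ltn_ord x; have := ltn_ord i; have := ltn_ord j; lia.
Qed.

(** * Averaging over permutations *)

(** List the elements of [A] followed by those of its complement, likewise for
    [B], and match the two lists position by position. *)
Lemma perm_imset_transitive (T : finType) (A B : {set T}) :
  #|A| = #|B| -> exists p : {perm T}, p @: A = B.
Proof.
move=> eAB; pose listing (C : {set T}) := enum C ++ enum (~: C).
have size_listing C : size (listing C) = #|T|.
  by rewrite size_cat -!cardE cardsC.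
have uniq_listing C : uniq (listing C).
  rewrite cat_uniq !enum_uniq andbT /=; apply/hasPn => x.
  by rewrite !mem_enum inE.
have mem_listing C x : x \in listing C.
  by rewrite mem_cat !mem_enum inE orbN.
pose f x := nth x (listing B) (index x (listing A)).
have lt_index x : index x (listing A) < size (listing B).
  by rewrite size_listing -(size_listing A) index_mem mem_listing.
have f_inj : injective f.
  move=> x y; rewrite /f (set_nth_default x y) ?lt_index // => /eqP.
  rewrite nth_uniq ?lt_index // => /eqP e.
  by apply: index_inj e; rewrite ?mem_listing.
exists (perm f_inj); apply/eqP; rewrite eqEcard card_imset ?eAB ?leqnn ?andbT.
  apply/subsetP => _ /imsetP[x xA ->]; rewrite permE /f.
  have lt_A : index x (listing A) < size (enum B).
    by rewrite index_cat mem_enum xA -cardE -eAB cardE index_mem mem_enum.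
  by rewrite nth_cat lt_A -mem_enum mem_nth.
exact: perm_inj.
Qed.

Local Open Scope group_scope.

(** By transitivity the fibre over [B] does not depend on [B]: composing with a
    permutation that takes [B] to [C] carries one fibre onto the other. *)
Lemma card_perm_fibre (T : finType) (A B C : {set T}) : #|B| = #|C| ->
  #|[set s : {perm T} | s @: A == B]| = #|[set s : {perm T} | s @: A == C]|.
Proof.
move=> /perm_imset_transitive[p pBC].
rewrite -[RHS](card_preimset _ (mulIg p)); apply: eq_card => s; rewrite !inE.
have -> : (s * p) @: A = p @: (s @: A).
  by rewrite -imset_comp; apply: eq_imset => x; rewrite /= permM.
by rewrite -pBC; apply/eqP/eqP => [->|/(imset_inj perm_inj)].
Qed.

Lemma card_all_perms (T : finType) : #|{perm T}| = #|T|`!.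
Proof.
rewrite -[in RHS]cardsT -card_perm; apply: eq_card => s.
by rewrite !inE; apply/esym/subsetP => x; rewrite inE.
Qed.

Lemma card_perms_by_fibre (T : finType) (A : {set T}) (F : {set {set T}}) :
  #|[set s : {perm T} | s @: A \in F]| =
    (\sum_(B in F) #|[set s : {perm T} | s @: A == B]|)%N.
Proof.
rewrite -sum1dep_card (partition_big (fun s : {perm T} => s @: A) (mem F)) //=.
apply: eq_bigr => B BF; rewrite -sum1dep_card; apply: eq_bigl => s.
by apply/andb_idl => /eqP ->.
Qed.

Lemma card_perms_into_family (T : finType) (k : nat) (A : {set T})
    (F : {set {set T}}) :
  #|A| = k -> {in F, forall B : {set T}, #|B| = k} ->
  (#|[set s : {perm T} | s @: A \in F]| * 'C(#|T|, k) = #|F| * #|T|`!)%N.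
Proof.
move=> cA cF; pose c := #|[set s : {perm T} | s @: A == A]|.
have fibre (G : {set {set T}}) : {in G, forall B : {set T}, #|B| = k} ->
    #|[set s : {perm T} | s @: A \in G]| = (#|G| * c)%N.
  move=> cG; rewrite card_perms_by_fibre -sum_nat_const.
  by apply: eq_bigr => B BG; apply: card_perm_fibre; rewrite cG.
(* The same count for the family of all k-sets determines the fibre size. *)
have total : ('C(#|T|, k) * c = #|T|`!)%N.
  rewrite -card_draws -fibre; last by move=> B; rewrite inE => /eqP.
  rewrite -card_all_perms; apply: eq_card => s.
  by rewrite !inE card_imset ?cA ?eqxx //; apply: perm_inj.
by rewrite fibre // -total -mulnA (mulnC c).
Qed.

Local Close Scope group_scope.

(** * Dissociated families of k-sets *)

(** Double counting of the pairs of a permutation [s] and a starting point [i]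
    such that [s] sends the arc at [i] into [F]: each [s] contributes at most
    [k + 1] of them, each [i] exactly [#|F| * n`! / 'C(n, k)]. *)
Lemma card_dissociated_family (n k : nat) (F : {set {set 'I_n}}) :
  0 < k -> 2 * k <= n -> 3 * k <= n + 1 ->
  {in F, forall A : {set 'I_n}, #|A| = k} ->
  {in F & &, forall A B C : {set 'I_n},
     [disjoint A & B] -> [disjoint A & C] -> B = C} ->
  n * #|F| <= (k + 1) * 'C(n, k).
Proof.
case: n F => [|m] F k_gt0 le2kn le3kn cF dF; first by rewrite mul0n.
have lekn : k <= m.+1 by lia.
pose hits (s : {perm 'I_m.+1}) := [set i | s @: arc k i \in F].
have hits_le s : #|hits s| <= k + 1.
  apply: card_dissociated_starts => // i j j'; rewrite !inE => iF jF jF' fj fj'.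
  have disj (l : 'I_m.+1) : far m.+1 k i l -> [disjoint s @: arc k i & s @: arc k l].
    move=> fil; rewrite imset_disjoint ?arc_disjoint //; exact: perm_inj.
  have := dF _ _ _ iF jF jF' (disj _ fj) (disj _ fj').
  by move/(imset_inj perm_inj)/(arc_inj k_gt0 le2kn).
rewrite -(leq_pmul2r (fact_gt0 m.+1)).
have <- : \sum_(s : {perm 'I_m.+1}) #|hits s| * 'C(m.+1, k)
          = m.+1 * #|F| * m.+1`!.
  rewrite -big_distrl /=.
  under eq_bigr => s _ do rewrite -sum1dep_card big_mkcond /=.
  rewrite exchange_big /= big_distrl /=.
  rewrite (eq_bigr (fun=> #|F| * m.+1`!)) => [|i _].
    by rewrite sum_nat_const card_ord mulnA.
  rewrite -big_mkcond sum1dep_card.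
  have := card_perms_into_family (card_arc i lekn) cF.
  by rewrite card_ord.
rewrite mulnC -[in m.+1`!](card_ord m.+1) -card_all_perms.
rewrite -sum_nat_const; apply: leq_sum => s _.
by rewrite leq_mul2r hits_le orbT.
Qed.

Lemma diss_kneser_le (n k : nat) :
  0 < k -> 2 * k <= n -> 3 * k <= n + 1 ->
  n * diss (@kneser n k) <= (k + 1) * 'C(n, k).
Proof.
move=> k_gt0 le2kn le3kn; have n_gt0 : 0 < n by lia.
rewrite mulnC -leq_divRL //; apply/bigmax_leqP => D hD.
rewrite leq_divRL // mulnC -(card_imset (mem D) val_inj).
apply: card_dissociated_family => // [_ /imsetP[A _ ->]|].
  exact/eqP/(valP A).
move=> _ _ _ /imsetP[A AD ->] /imsetP[B BD ->] /imsetP[C CD ->] AB AC.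
by rewrite (dissociation_set_unique hD AD BD CD AB AC).
Qed.

Theorem mainTheorem4 (n k r : nat) (hk : (1 <= k)%N) (hr : (1 <= r)%N)
    (hn : n = (2 * k + r)%N) (hrk : (k%:Z - 2 < r%:Z)%R) :
  ((diss (@kneser n k))%:R <=
     (k + 1)%:R / k%:R * ('C(n - 1, k - 1))%:R :> rat)%R.
Proof.
have le2kn : 2 * k <= n by lia.
have le3kn : 3 * k <= n + 1 by lia.
have n_gt0 : 0 < n by lia.
have le_diss := diss_kneser_le hk le2kn le3kn.
have binE : n * 'C(n - 1, k - 1) = k * 'C(n, k).
  by case: (n) (k) n_gt0 hk => [|m] [|j] // _ _; rewrite !subn1 mul_bin_diag.
have le_nat : diss (@kneser n k) * k <= (k + 1) * 'C(n - 1, k - 1).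
  rewrite -(leq_pmul2l n_gt0) mulnA [leqRHS]mulnCA binE.
  by rewrite mulnCA mulnC leq_mul2l le_diss orbT.
rewrite mulrAC ler_pdivlMr ?ltr0n // -!natrM ler_nat //.
Qed.
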